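(* Let $\Lambda,\Lambda_1,\Lambda_2$ be three $A$-lattices of the same rank $r\geqslant1$ such that $\Lambda\subseteq\Lambda_1\cap\Lambda_2$. Then $\Lambda_1\cap\Lambda_2$ and $\Lambda_1+\Lambda_2$ are also $A$-lattices of rank $r$. Moreover, we have $$\log_q\mathcal{D}(\Lambda_1\cap\Lambda_2)+\log_q\mathcal{D}(\Lambda_1+\Lambda_2)=\log_q\mathcal{D}(\Lambda_1)+\log_q\mathcal{D}(\Lambda_2).$$
   Context: $\mathbb{F}_q$ is a finite field with $q$ elements, $A=\mathbb{F}_q[T]$, $K_0=\mathbb{F}_q(T)$, and $\mathrm{ord}_\infty$ is the valuation on $K_0$ with $\mathrm{ord}_\infty(a)=-\deg a$ for $a\in A$. $\mathbb{C}_\infty$ is the completion of an algebraic closure of the completion $K_{0,\infty}$ of $K_0$ at $\infty$, with normalized absolute value $|x|_\infty=q^{-\mathrm{ord}_\infty(x)}$ ($\mathrm{ord}_\infty$ extended to $\mathbb{C}_\infty$). An $A$-lattice is a finitely generated $A$-submodule $\Lambda\subset\mathbb{C}_\infty$ which is discrete (it has finite intersection with every ball of $\mathbb{C}_\infty$); its rank is its rank as an $A$-module (it is torsion-free, hence free). A successive minimum basis of a rank $r$ lattice $\Lambda$ is an ordered $A$-basis $(\eta_1,\dots,\eta_r)$ of $\Lambda$ with $|\eta_1|_\infty\geqslant\dots\geqslant|\eta_r|_\infty$ such that, for each $k$, $\eta_k$ has minimal absolute value among the elements of $\Lambda\smallsetminus(A\eta_{k+1}+\dots+A\eta_r)$ (for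 $k=r$: among nonzero elements of $\Lambda$). Such a basis exists and the tuple $(|\eta_1|_\infty,\dots,|\eta_r|_\infty)$ depends only on $\Lambda$. The covolume of $\Lambda$ is $\mathcal{D}(\Lambda)=|\eta_1|_\infty\cdots|\eta_r|_\infty$ for any successive minimum basis. *)

(* Defs.v *)
From HB Require Import structures.
From mathcomp Require Import all_boot all_order all_algebra.
From mathcomp Require Import boolp classical_sets functions cardinality.
From mathcomp Require Import reals exp.
Set Implicit Arguments.
Unset Strict Implicit.
Unset Printing Implicit Defensive.
Import Order.TTheory GRing.Theory Num.Theory.
Local Open Scope classical_set_scope.
Local Open Scope ring_scope.

Section AbsoluteValues.
Variables (R : realType) (K : fieldType) (abs : K -> R).

Definition is_nonarch_absval : Prop :=
  [/\ forall x, 0 <= abs x,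
      forall x, abs x = 0 <-> x = 0,
      forall x y, abs (x * y) = abs x * abs y
    & forall x y, abs (x + y) <= Num.max (abs x) (abs y)].

Definition abs_cauchy (u : nat -> K) : Prop :=
  forall e : R, 0 < e ->
    exists N, forall m n, (N <= m)%N -> (N <= n)%N -> abs (u m - u n) < e.

Definition abs_cvg_to (u : nat -> K) (l : K) : Prop :=
  forall e : R, 0 < e -> exists N, forall n, (N <= n)%N -> abs (u n - l) < e.

Definition abs_complete : Prop :=
  forall u : nat -> K, abs_cauchy u -> exists l, abs_cvg_to u l.

End AbsoluteValues.

Definition is_completion (R : realType) (K K' : fieldType)
    (abs : K -> R) (abs' : K' -> R) (f : {rmorphism K -> K'}) : Prop :=
  [/\ is_nonarch_absval abs',
      forall x, abs' (f x) = abs x,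
      forall (y : K') (e : R), 0 < e -> exists x : K, abs' (y - f x) < e
    & abs_complete abs'].

Definition is_algebraic_closure (K K' : fieldType)
    (f : {rmorphism K -> K'}) : Prop :=
  GRing.closed_field_axiom K' /\ forall x : K', algebraicOver f x.

(* ord_infty of a nonzero n/d is deg d - deg n; since [size] is degree + 1 the
   shifts cancel.  The value at 0 is never used. *)
Definition ord_infty (F : finFieldType) (x : {fraction {poly F}}) : int :=
  (size (\d_(repr x)))%:Z - (size (\n_(repr x)))%:Z.

Definition abs_K0 (R : realType) (F : finFieldType)
    (x : {fraction {poly F}}) : R :=
  if x == 0 then 0 else (#|F|%:R : R) ^ (- ord_infty x).

(* The field C_infty, presented by the tower K_0 -> K_{0,infty} -> algebraic
   closure -> C_infty, which determines it up to isometric isomorphism.  The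
   absolute value is real-valued, with values in R. *)
Record Cinfty_tower (R : realType) (F : finFieldType) := CinftyTower {
  K0inf : fieldType;
  abs_K0inf : K0inf -> R;
  K0_to_K0inf : {rmorphism {fraction {poly F}} -> K0inf};
  K0inf_completion : is_completion (@abs_K0 R F) abs_K0inf K0_to_K0inf;
  K0bar : fieldType;
  abs_K0bar : K0bar -> R;
  K0inf_to_K0bar : {rmorphism K0inf -> K0bar};
  K0bar_closure : is_algebraic_closure K0inf_to_K0bar;
  K0bar_absval : is_nonarch_absval abs_K0bar;
  K0bar_extends : forall x, abs_K0bar (K0inf_to_K0bar x) = abs_K0inf x;
  Cinfty :> fieldType;
  absC : Cinfty -> R;
  K0bar_to_C : {rmorphism K0bar -> Cinfty};
  Cinfty_completion : is_completion abs_K0bar absC K0bar_to_C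
}.

Section Lattices.
Variables (R : realType) (F : finFieldType) (C : Cinfty_tower R F).
Implicit Types (L M : set C).

Definition A_to_C (a : {poly F}) : C :=
  K0bar_to_C C (K0inf_to_K0bar C (K0_to_K0inf C (tofrac a))).

Definition A_comb n (a : 'I_n -> {poly F}) (v : 'I_n -> C) : C :=
  \sum_(i < n) A_to_C (a i) * v i.

Definition A_span n (v : 'I_n -> C) : set C :=
  [set x | exists a : 'I_n -> {poly F}, x = A_comb a v].

Definition A_free n (v : 'I_n -> C) : Prop :=
  forall a : 'I_n -> {poly F}, A_comb a v = 0 -> forall i, a i = 0.

Definition A_basis n (v : 'I_n -> C) L : Prop := A_free v /\ A_span v = L.

Definition fg_A_submodule L : Prop :=
  exists n (v : 'I_n -> C), L = A_span v.

Definition discrete L : Prop :=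
  forall (c : C) (rho : R), finite_set (L `&` [set x | absC (x - c) <= rho]).

Definition A_lattice L : Prop := fg_A_submodule L /\ discrete L.

(* The rank of a module over a domain: the maximal number of linearly
   independent elements. *)
Definition has_A_rank L (r : nat) : Prop :=
  (exists v : 'I_r -> C, (forall i, L (v i)) /\ A_free v) /\
  (forall n (v : 'I_n -> C), (forall i, L (v i)) -> A_free v -> (n <= r)%N).

Definition lattice_of_rank (r : nat) L : Prop := A_lattice L /\ has_A_rank L r.

(* A eta_{k+1} + ... + A eta_r *)
Definition tail_span r (eta : 'I_r -> C) (k : 'I_r) : set C :=
  [set x | exists a : 'I_r -> {poly F},
             x = \sum_(i < r | (k < i)%N) A_to_C (a i) * eta i].

Definition succ_min_basis r (eta : 'I_r -> C) L : Prop :=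
  [/\ A_basis eta L,
      forall i j : 'I_r, (i <= j)%N -> absC (eta j) <= absC (eta i)
    & forall k : 'I_r, (L `\` tail_span eta k) (eta k) /\
        forall x, (L `\` tail_span eta k) x -> absC (eta k) <= absC x].

(* Every lattice has a successive minimum basis and the product below does not
   depend on it; the default 0 is only taken on sets that have none. *)
Definition covolume L : R :=
  xget 0 [set d | exists r (eta : 'I_r -> C),
                    succ_min_basis eta L /\ d = \prod_(i < r) absC (eta i)].

Definition set_add L M : set C := [set x + y | x in L & y in M].

End Lattices.

Definition logq (R : realType) (F : finFieldType) (x : R) : R :=
  ln x / ln (#|F|%:R).

(* Main.v *)
(** A successive minimum basis is orthogonal: |a_1 eta_1 + ... + a_r eta_r| is
    the maximum of the |a_i| |eta_i|.  Applying Leibniz' formula to a transition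
    matrix T between two such bases, and to its adjugate, gives
    D(M') = |det T| D(M) whenever M' is a sublattice of M.  Taking M = L1 + L2
    as reference, with matrices T1, T2, T0 for L1, L2 and their intersection, it
    remains to see that det T0 and det T1 * det T2 are associate.  This holds
    because L1 x L2 has, besides its product basis, the basis made of the
    (x, -x) for x in a basis of the intersection and of lifts of a basis of
    L1 + L2.  That L1 + L2 is discrete follows from d (L1 + L2) being contained
    in L for some nonzero d in A. *)

From HB Require Import structures.
Require Import Defs.
From mathcomp Require Import all_boot all_order all_algebra.
From mathcomp Require Import boolp classical_sets functions cardinality.
From mathcomp Require Import reals exp.
Set Implicit Arguments.
Unset Strict Implicit.
Unset Printing Implicit Defensive.
Import Order.TTheory GRing.Theory Num.Theory.
Local Open Scope classical_set_scope.
Local Open Scope ring_scope.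

HB.instance Definition _ R F (C : Cinfty_tower R F) :=
  GRing.RMorphism.copy (A_to_C C)
    (K0bar_to_C C \o K0inf_to_K0bar C \o K0_to_K0inf C \o (@tofrac _)).

(** * Determinants for the sum and intersection of row spaces *)

Section BlockDeterminant.
Variables (A : comNzRingType) (r : nat).
Implicit Types B M S U V W : 'M[A]_r.

(* The row spaces of [B1], [B2] and [B0] play the roles of L1, L2 and their
   intersection, in coordinates where L1 + L2 is the standard lattice. *)
Lemma det_capmx_associate B1 B2 B0 U V S1 S2 :
    U *m B1 + V *m B2 = 1%:M -> B0 = S1 *m B1 -> B0 = S2 *m B2 ->
    (forall M S S', M = S *m B1 -> M = S' *m B2 -> exists W, M = W *m B0) ->
  exists c d, \det B0 = c * (\det B1 * \det B2) /\
              \det B1 * \det B2 = d * \det B0.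
Proof.
move=> UV e1 e2 cap.
(* Two bases of L1 x L2: the rows of [Q] are the product basis; those of [P] are the pairs (x, -x)
   for x in the intersection, then the lifts of the standard basis given by [UV]. *)
set P := block_mx B0 (- B0) (U *m B1) (V *m B2).
set Q := block_mx B1 0 0 B2.
have detP : \det P = \det B0.
  (* Adding the first block column to the second sends each pair (x, y) to (x, x + y), which makes
     [P] triangular. *)
  have : P *m block_mx 1%:M 1%:M 0 1%:M = block_mx B0 0 (U *m B1) 1%:M.
    rewrite mulmx_block !mulmx1 !mulmx0 !addr0 addrN UV.
    by congr block_mx.
  by move=> /(congr1 determinant); rewrite det_mulmx det_ublock det_lblock !det1 !mulr1.
have detQ : \det Q = \det B1 * \det B2 by rewrite det_ublock.
(* A row (b, 0) of [Q] minus the lift of b has the form (x, -x), so x lies in both row spaces and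
   [cap] applies. [W2] does the same for the rows (0, b). *)
have [W1 W1E] : exists W, B1 - B1 *m (U *m B1) = W *m B0.
  apply: (cap _ (1%:M - B1 *m U) (B1 *m V)).
    by rewrite mulmxBl mul1mx mulmxA.
  by rewrite -[X in X - _]mulmx1 -UV mulmxDr addrC addKr mulmxA.
have [W2 W2E] : exists W, - (B2 *m (U *m B1)) = W *m B0.
  apply: (cap _ (- (B2 *m U)) (B2 *m V - 1%:M)).
    by rewrite mulNmx mulmxA.
  have e : B2 = B2 *m (U *m B1) + B2 *m (V *m B2) by rewrite -mulmxDr UV mulmx1.
  by rewrite mulmxBl mul1mx -mulmxA [in X in _ - X]e opprD addrCA addrN addr0.
(* The transition matrices: [P] is the first one times [Q], and [Q] is the second one times [P]. *)
exists (\det (block_mx S1 (- S2) U V)), (\det (block_mx W1 B1 W2 B2)).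
rewrite -detP -detQ -!det_mulmx; split; congr (\det _).
  by rewrite /P mulmx_block !mulmx0 !addr0 !add0r mulNmx -e1 -e2.
rewrite mulmx_block !mulmxN -W1E -W2E subrK addNr.
have -> : V *m B2 = 1%:M - U *m B1 by rewrite -UV addrC addKr.
by rewrite !mulmxBr !mulmx1 addNr opprK addrCA addrN addr0.
Qed.

End BlockDeterminant.

(** Zero columns pad the matrix to a square one, whose determinant vanishes. *)
Lemma wide_row_kernel (A : idomainType) m n (M : 'M[A]_(m, n)) :
  (n < m)%N -> exists2 u : 'rV_m, u != 0 & u *m M = 0.
Proof.
move=> ltnm.
(* The successor form shows that at least one column is added, so that [ord0] indexes a zero
   column. *)
have e : (n + (m - n).-1.+1 = m)%N by rewrite prednK ?subn_gt0 // subnKC // ltnW.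
pose M' := castmx (erefl m, e) (row_mx M 0).
have : \det M' == 0.
  rewrite -det_tr (expand_det_row _ (cast_ord e (rshift n ord0))) big1 // => i _.
  by rewrite mxE castmxE /= cast_ordK row_mxEr mxE mul0r.
move=> /det0P[u u0 uM]; exists u => //; apply/rowP => j.
have /rowP/(_ (cast_ord e (lshift _ j))) := uM; rewrite !mxE => uMj.
by rewrite -[RHS]uMj; apply: eq_bigr => i _;
  rewrite castmxE /= cast_ordK row_mxEl cast_ord_id.
Qed.

Lemma seq_min (T : eqType) (R : realType) (f : T -> R) (s : seq T) (P : T -> Prop) x0 :
  x0 \in s -> P x0 ->
  exists x, [/\ x \in s, P x & forall y, y \in s -> P y -> f x <= f y].
Proof.
elim: s x0 => // z s IH x0; rewrite inE => zs Px0.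
have [[y ys Py]|no] := pselect (exists2 y, y \in s & P y); last first.
  have ez : x0 = z by case/orP: zs => [/eqP//|ys]; case: no; exists x0.
  subst z; exists x0; rewrite mem_head; split=> // y; rewrite inE => /orP[/eqP->//|ys Py].
  by case: no; exists y.
have [x [xs Px xmin]] := IH _ ys Py.
have [[Pz zx]|nz] := pselect (P z /\ f z <= f x).
  exists z; rewrite mem_head; split=> // t; rewrite inE => /orP[/eqP->//|ts Pt].
  exact: le_trans zx (xmin _ ts Pt).
exists x; rewrite inE xs orbT; split=> // t.
rewrite inE => /orP[/eqP->|ts Pt] //; last exact: xmin.
by move=> Pz; rewrite leNgt; apply/negP => /ltW zx; apply: nz.
Qed.

(** * The absolute value on C_infty and its restriction to A *)

Section Absolute.
Variables (R : realType) (F : finFieldType) (C : Cinfty_tower R F).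
Local Notation A := {poly F}.

Let absP : is_nonarch_absval (@absC R F C).
Proof. by case: (Cinfty_completion C). Qed.

Lemma absC_ge0 (x : C) : 0 <= absC x. Proof. by case: absP. Qed.

Lemma absC_eq0 (x : C) : (absC x == 0) = (x == 0).
Proof. by case: absP => _ h _ _; apply/eqP/eqP => /h. Qed.

Lemma absC0 : absC (0 : C) = 0. Proof. by apply/eqP; rewrite absC_eq0. Qed.

Lemma absC_gt0 (x : C) : (0 < absC x) = (x != 0).
Proof. by rewrite lt_def absC_ge0 andbT absC_eq0. Qed.

Lemma absCM (x y : C) : absC (x * y) = absC x * absC y.
Proof. by case: absP. Qed.

Lemma absC_addP (x y : C) : absC (x + y) <= Num.max (absC x) (absC y).
Proof. by case: absP. Qed.

Lemma absC1 : absC (1 : C) = 1.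
Proof.
have n0 : absC (1 : C) != 0 by rewrite absC_eq0 oner_eq0.
by apply: (mulfI n0); rewrite -absCM !mulr1.
Qed.

Lemma absCX (x : C) n : absC (x ^+ n) = absC x ^+ n.
Proof. by elim: n => [|n IH]; rewrite ?expr0 ?absC1 // !exprS absCM IH. Qed.

Lemma absCN (x : C) : absC (- x) = absC x.
Proof.
suff N1 : absC (-1 : C) = 1 by rewrite -mulN1r absCM N1 mul1r.
apply/eqP; rewrite -(@eqrXn2 _ 2) ?absC_ge0 ?ler01 //.
by rewrite expr1n expr2 -absCM mulrNN mulr1 absC1.
Qed.

Lemma absC_le_add (x y : C) e : absC x <= e -> absC y <= e -> absC (x + y) <= e.
Proof. by move=> xe ye; apply: le_trans (absC_addP x y) _; rewrite ge_max xe. Qed.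

Lemma absC_lt_add (x y : C) e : absC x < e -> absC y < e -> absC (x + y) < e.
Proof. by move=> xe ye; apply: le_lt_trans (absC_addP x y) _; rewrite gt_max xe. Qed.

Lemma absC_sum_le (I : finType) (P : pred I) (f : I -> C) e :
  0 <= e -> (forall i, P i -> absC (f i) <= e) -> absC (\sum_(i | P i) f i) <= e.
Proof.
move=> e0 fe; elim/big_ind: _ => //; first by rewrite absC0.
by move=> x y; apply: absC_le_add.
Qed.

Lemma absC_sum_lt (I : finType) (P : pred I) (f : I -> C) e :
  0 < e -> (forall i, P i -> absC (f i) < e) -> absC (\sum_(i | P i) f i) < e.
Proof.
move=> e0 fe; elim/big_ind: _ => //; first by rewrite absC0.
by move=> x y; apply: absC_lt_add.
Qed.

Lemma absC_prod (I : finType) (f : I -> C) :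
  absC (\prod_i f i) = \prod_i absC (f i).
Proof. by apply: (big_morph _ absCM absC1). Qed.

Lemma card_finField_gt1 : 1 < #|F|%:R :> R.
Proof. by rewrite ltr1n card_finNzRing_gt1. Qed.

Lemma absC_A_to_C (a : A) :
  a != 0 -> absC (A_to_C C a) = #|F|%:R ^+ (size a).-1.
Proof.
move=> a0; rewrite /A_to_C.
case: (Cinfty_completion C) => _ -> _ _; rewrite K0bar_extends.
case: (K0inf_completion C) => _ -> _ _.
rewrite /abs_K0 tofrac_eq0 (negPf a0) /ord_infty.
set y := repr _.
have d0 : \d_y != 0 by apply: denom_ratioP.
(* [repr] picks an unspecified fraction equal to a/1, so its denominator may be any nonzero
   polynomial; it cancels in the difference of sizes. *)
have e : \n_y = a * \d_y.
  have := equivf_r (Ratio a 1); rewrite !numden_Ratio ?oner_eq0 //.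
  by rewrite mul1r /y; unlock tofrac => ->.
rewrite e size_mul // opprB.
have : (0 < size a)%N by rewrite size_poly_gt0.
case: (size a) => // s _; rewrite addSn /= PoszD addrK.
by rewrite exprnP.
Qed.

Lemma absC_A_to_C_ge1 (a : A) : a != 0 -> 1 <= absC (A_to_C C a).
Proof. by move=> a0; rewrite absC_A_to_C // exprn_ege1 // ltW // card_finField_gt1. Qed.

Lemma absC_A_to_C_lt (a b : A) :
  (size a < size b)%N -> absC (A_to_C C a) < absC (A_to_C C b).
Proof.
move=> ab; have b0 : b != 0 by rewrite -size_poly_gt0 (leq_trans _ ab).
have [->|a0] := eqVneq a 0.
  by rewrite rmorph0 absC0 (lt_le_trans ltr01) // absC_A_to_C_ge1.
rewrite !absC_A_to_C // ltr_eXn2l ?card_finField_gt1 //.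
by move: ab; rewrite -(size_poly_gt0 a) in a0 *; case: (size a) a0 => // ? _;
  case: (size b).
Qed.

Lemma A_to_C_eq0 (a : A) : (A_to_C C a == 0) = (a == 0).
Proof.
have [->|a0] := eqVneq a 0; first by rewrite rmorph0 eqxx.
by apply/negbTE; rewrite -absC_gt0 (lt_le_trans ltr01) // absC_A_to_C_ge1.
Qed.

(** By the ultrametric inequality it is enough to bound each term of Leibniz' formula, and a
    permutation does not change the product of the [e i]. *)
Lemma absC_det_le n (M : 'M[A]_n) (e e' : 'I_n -> R) :
    (forall i, 0 <= e i) -> (forall i, 0 <= e' i) ->
    (forall i j, absC (A_to_C C (M i j)) * e j <= e' i) ->
  absC (A_to_C C (\det M)) * \prod_i e i <= \prod_i e' i.
Proof.
move=> e0 e'0 Me.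
have [p0|pn0] := eqVneq (\prod_i e i) 0.
  by rewrite p0 mulr0; apply: prodr_ge0.
have pgt0 : 0 < \prod_i e i by rewrite lt_def pn0 prodr_ge0.
rewrite -ler_pdivlMr // rmorph_sum; apply: absC_sum_le => [|s _].
  by rewrite divr_ge0 ?prodr_ge0.
rewrite ler_pdivlMr // rmorphM rmorph_sign absCM rmorph_prod absC_prod.
have -> : absC ((-1) ^+ perm.odd_perm s : C) = 1.
  by case: perm.odd_perm; rewrite ?expr1 ?absCN absC1.
rewrite mul1r [X in _ * X](reindex_inj (@perm.perm_inj _ s)) /= -big_split /=.
by apply: ler_prod => i _; rewrite mulr_ge0 ?absC_ge0 ?Me.
Qed.

End Absolute.

(** * Combinations, spans and transition matrices over A *)

Section Modules.
Variables (R : realType) (F : finFieldType) (C : Cinfty_tower R F).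
Local Notation A := {poly F}.
Implicit Types (M L : set C).

Lemma A_comb0 n (v : 'I_n -> C) : A_comb (fun=> 0) v = 0.
Proof. by rewrite /A_comb big1 // => i _; rewrite rmorph0 mul0r. Qed.

Lemma A_combD n (a b : 'I_n -> A) (v : 'I_n -> C) :
  A_comb (fun i => a i + b i) v = A_comb a v + A_comb b v.
Proof. by rewrite -big_split; apply: eq_bigr => i _; rewrite rmorphD mulrDl. Qed.

Lemma A_combZ n c (a : 'I_n -> A) (v : 'I_n -> C) :
  A_comb (fun i => c * a i) v = A_to_C C c * A_comb a v.
Proof. by rewrite mulr_sumr; apply: eq_bigr => i _; rewrite rmorphM mulrA. Qed.

Lemma A_combB n (a b : 'I_n -> A) (v : 'I_n -> C) :
  A_comb (fun i => a i - b i) v = A_comb a v - A_comb b v.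
Proof. by rewrite -sumrB; apply: eq_bigr => i _; rewrite rmorphB mulrBl. Qed.

Lemma A_comb_delta n (v : 'I_n -> C) i : A_comb (fun j => (j == i)%:R) v = v i.
Proof.
rewrite /A_comb (bigD1 i) //= eqxx rmorph1 mul1r big1 ?addr0 // => j /negPf->.
by rewrite rmorph0 mul0r.
Qed.

Lemma A_comb_recl n (a : 'I_n.+1 -> A) (v : 'I_n.+1 -> C) :
  A_comb a v = A_to_C C (a ord0) * v ord0 +
    A_comb (fun i => a (lift ord0 i)) (fun i => v (lift ord0 i)).
Proof. by rewrite /A_comb big_ord_recl. Qed.

Lemma A_comb_mulmx m n p (S : 'M[A]_(m, n)) (T : 'M[A]_(n, p)) (v : 'I_p -> C) i :
  A_comb ((S *m T) i) v = A_comb (S i) (fun j => A_comb (T j) v).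
Proof.
rewrite /A_comb; under [RHS]eq_bigr do rewrite mulr_sumr.
rewrite exchange_big; apply: eq_bigr => k _ /=.
rewrite mxE rmorph_sum mulr_suml; apply: eq_bigr => j _.
by rewrite rmorphM mulrA.
Qed.

Lemma A_comb_addmx m n (S T : 'M[A]_(m, n)) (v : 'I_n -> C) i :
  A_comb ((S + T) i) v = A_comb (S i) v + A_comb (T i) v.
Proof. by rewrite -A_combD; congr (A_comb _ v); apply/funext => j; rewrite mxE. Qed.

Lemma A_comb_scalar_mx n d (v : 'I_n -> C) i :
  A_comb (d%:M i : 'I_n -> A) v = A_to_C C d * v i.
Proof.
rewrite -[in RHS](A_comb_delta v) -A_combZ; congr (A_comb _ v); apply/funext => j.
by rewrite mxE eq_sym mulr_natr.
Qed.

Definition A_submodule M : Prop :=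
  [/\ M 0, forall x y, M x -> M y -> M (x + y)
    & forall a x, M x -> M (A_to_C C a * x)].

Lemma A_submodule_comb M n (a : 'I_n -> A) (v : 'I_n -> C) :
  A_submodule M -> (forall i, M (v i)) -> M (A_comb a v).
Proof.
move=> [M0 MD MZ] Mv; rewrite /A_comb; elim/big_ind: _ => // i _; exact: MZ.
Qed.

Lemma A_submodule_span n (v : 'I_n -> C) : A_submodule (A_span v).
Proof.
split=> [|x y [a ->] [b ->]|c x [a ->]].
- by exists (fun=> 0); rewrite A_comb0.
- by exists (fun i => a i + b i); rewrite A_combD.
- by exists (fun i => c * a i); rewrite A_combZ.
Qed.

Lemma A_span_gen n (v : 'I_n -> C) i : A_span v (v i).
Proof. by exists (fun j => (j == i)%:R); rewrite A_comb_delta. Qed.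

Lemma A_submoduleI M L : A_submodule M -> A_submodule L -> A_submodule (M `&` L).
Proof.
move=> [M0 MD MZ] [L0 LD LZ]; split=> //.
- by move=> x y [? ?] [? ?]; split; [apply: MD|apply: LD].
- by move=> a x [? ?]; split; [apply: MZ|apply: LZ].
Qed.

Lemma A_submodule_add M L : A_submodule M -> A_submodule L -> A_submodule (set_add M L).
Proof.
move=> [M0 MD MZ] [L0 LD LZ]; split.
- by exists 0 => //; exists 0; rewrite ?addr0.
- move=> _ _ [x Mx [y Ly <-]] [x' Mx' [y' Ly' <-]].
  exists (x + x'); first exact: MD.
  by exists (y + y'); [exact: LD|rewrite addrACA].
- move=> a _ [x Mx [y Ly <-]]; exists (A_to_C C a * x); first exact: MZ.
  by exists (A_to_C C a * y); [exact: LZ|rewrite mulrDr].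
Qed.

Lemma A_span_matrix m n (v : 'I_m -> C) (w : 'I_n -> C) :
  (forall i, A_span w (v i)) ->
  exists T : 'M[A]_(m, n), v = fun i => A_comb (T i) w.
Proof.
move=> /choice[T vE]; exists (\matrix_(i, j) T i j); apply/funext => i.
by rewrite vE; congr (A_comb _ w); apply/funext => j; rewrite mxE.
Qed.

Lemma A_free_inj m n (S T : 'M[A]_(m, n)) (v : 'I_n -> C) : A_free v ->
  (forall i, A_comb (S i) v = A_comb (T i) v) -> S = T.
Proof.
move=> fv ST; apply/matrixP => i j; apply/eqP; rewrite -subr_eq0; apply/eqP.
by apply: (fv (fun j => S i j - T i j)); rewrite A_combB ST subrr.
Qed.

Lemma A_free_rowP n (v : 'I_n -> C) (u : 'rV[A]_n) :
  A_free v -> A_comb (u 0) v = 0 -> u = 0.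
Proof. by move=> fv /fv u0; apply/rowP => j; rewrite u0 mxE. Qed.

(** If [m] exceeded [n], a nonzero row killed by the coefficient matrix would be a relation among
    the [v i]. *)
Lemma A_free_leq m n (v : 'I_m -> C) (w : 'I_n -> C) :
  A_free v -> (forall i, A_span w (v i)) -> (m <= n)%N.
Proof.
move=> fv /A_span_matrix[T vE]; rewrite leqNgt; apply/negP.
move=> /(wide_row_kernel T)[u u0 uT]; case/eqP: u0; apply: (A_free_rowP fv).
rewrite vE -A_comb_mulmx uT -[RHS](A_comb0 w); congr (A_comb _ w).
by apply/funext => j; rewrite mxE.
Qed.

Lemma A_free_det n (T : 'M[A]_n) (w : 'I_n -> C) :
  A_free (fun i => A_comb (T i) w) -> \det T != 0.
Proof.
move=> fv; apply/negP => /det0P[u u0 uT]; case/eqP: u0; apply: (A_free_rowP fv).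
rewrite -A_comb_mulmx uT -[RHS](A_comb0 w); congr (A_comb _ w).
by apply/funext => j; rewrite mxE.
Qed.

(** Inverts a change of family up to the factor [\det T], with coefficients still in A. *)
Lemma adj_comb n (T : 'M[A]_n) (w : 'I_n -> C) i :
  A_comb ((\adj T) i) (fun j => A_comb (T j) w) = A_to_C C (\det T) * w i.
Proof. by rewrite -A_comb_mulmx mul_adj_mx A_comb_scalar_mx. Qed.

(** * Families with their first member split off *)

Definition behead_fam n (v : 'I_n.+1 -> C) : 'I_n -> C := fun i => v (lift ord0 i).

(** Successive minimum bases list their longest member first, so a basis built from the shortest
    vector up grows at index 0. *)
Definition cons_fam T n (x : T) (v : 'I_n -> T) : 'I_n.+1 -> T :=
  fun i => oapp v x (unlift ord0 i).

Lemma cons_fam0 T n (x : T) (v : 'I_n -> T) : cons_fam x v ord0 = x.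
Proof. by rewrite /cons_fam unlift_none. Qed.

Lemma cons_famS T n (x : T) (v : 'I_n -> T) i : cons_fam x v (lift ord0 i) = v i.
Proof. by rewrite /cons_fam liftK. Qed.

Lemma behead_cons_fam n (x : C) (v : 'I_n -> C) : behead_fam (cons_fam x v) = v.
Proof. by apply/funext => i; rewrite /behead_fam cons_famS. Qed.

Lemma tail_span0 n (v : 'I_n.+1 -> C) : tail_span v ord0 = A_span (behead_fam v).
Proof.
have E (a : 'I_n.+1 -> A) : \sum_(i < n.+1 | (@ord0 n < i)%N) A_to_C C (a i) * v i =
    A_comb (fun i => a (lift ord0 i)) (behead_fam v).
  by rewrite big_mkcond big_ord_recl /= add0r.
apply/seteqP; split=> x [a ->]; first by exists (fun i => a (lift ord0 i)).
exists (cons_fam 0 a); rewrite E; congr (A_comb _ _); apply/funext => i.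
by rewrite cons_famS.
Qed.

Lemma tail_spanS n (v : 'I_n.+1 -> C) k :
  tail_span v (lift ord0 k) = tail_span (behead_fam v) k.
Proof.
have E (a : 'I_n.+1 -> A) :
    \sum_(i < n.+1 | (lift ord0 k < i)%N) A_to_C C (a i) * v i =
    \sum_(i < n | (k < i)%N) A_to_C C (a (lift ord0 i)) * behead_fam v i.
  by rewrite big_mkcond big_ord_recl /= add0r [RHS]big_mkcond.
apply/seteqP; split=> x [a ->]; first by exists (fun i => a (lift ord0 i)).
by exists (cons_fam 0 a); rewrite E; apply: eq_bigr => i _; rewrite cons_famS.
Qed.

Lemma tail_span_zero n (v : 'I_n -> C) k : tail_span v k 0.
Proof. by exists (fun=> 0); rewrite big1 // => i _; rewrite rmorph0 mul0r. Qed.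

Lemma tail_span_leq n (v : 'I_n -> C) (i j : 'I_n) :
  (i <= j)%N -> tail_span v j `<=` tail_span v i.
Proof.
move=> ij x [a ->]; exists (fun l : 'I_n => if (j < l)%N then a l else 0).
rewrite [RHS](bigID (fun l : 'I_n => (j < l)%N)) /= [X in _ = _ + X]big1 ?addr0; last first.
  by move=> l /andP[_ /negPf->]; rewrite rmorph0 mul0r.
apply: eq_big => [l|l ->] //.
by rewrite andbC; case: (ltnP j l) => //= jl; rewrite (leq_ltn_trans ij jl).
Qed.

Lemma tail_span_span n (v : 'I_n -> C) k : tail_span v k `<=` A_span v.
Proof.
move=> x [a ->]; exists (fun i : 'I_n => if (k < i)%N then a i else 0).
rewrite /A_comb big_mkcond; apply: eq_bigr => i _; case: ifP => // _.
by rewrite rmorph0 mul0r.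
Qed.

(* The third clause of [succ_min_basis], which makes sense for families that
   do not span yet. *)
Definition succ_min n (v : 'I_n -> C) M : Prop :=
  forall k, (M `\` tail_span v k) (v k) /\
    forall x, (M `\` tail_span v k) x -> absC (v k) <= absC x.

(** * Orthogonality of successive minima *)

Lemma succ_min_behead n (v : 'I_n.+1 -> C) M : succ_min v M -> succ_min (behead_fam v) M.
Proof. by move=> vM k; have := vM (lift ord0 k); rewrite tail_spanS. Qed.

Lemma succ_min_neq0 n (v : 'I_n -> C) M k : succ_min v M -> v k != 0.
Proof.
move=> vM; apply/eqP => v0; have [[_ h] _] := vM k.
by apply: h; rewrite v0; exact: tail_span_zero.
Qed.

Lemma succ_min_le n (v : 'I_n -> C) M x i :
  succ_min v M -> M x -> ~ A_span v x -> absC (v i) <= absC x.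
Proof.
by move=> vM Mx nx; have [_ h] := vM i; apply: h; split => // /tail_span_span.
Qed.

(** The tails at positive indices are those of [v], so only the condition at index 0 is new. *)
Lemma succ_min_cons n (v : 'I_n -> C) M x :
    succ_min v M -> M x -> ~ A_span v x ->
    (forall y, M y -> ~ A_span v y -> absC x <= absC y) ->
  succ_min (cons_fam x v) M.
Proof.
move=> vM Mx nx xmin k; case: (unliftP ord0 k) => [i|] ->.
  by rewrite tail_spanS behead_cons_fam cons_famS; exact: vM.
by rewrite tail_span0 behead_cons_fam cons_fam0; split=> // y [My ny]; apply: xmin.
Qed.

(* Euclidean division of the coefficients of the tail by [a] leaves a
   remainder shorter than [a * x], and what is divided is absorbed in [x],
   which stays at least as long by minimality. *)
Lemma succ_min_cons_le n (v : 'I_n -> C) M x a (b : 'I_n -> A) :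
    A_submodule M -> succ_min v M -> M x -> ~ A_span v x ->
    (forall y, M y -> ~ A_span v y -> absC x <= absC y) ->
  absC (A_to_C C a) * absC x <= absC (A_to_C C a * x + A_comb b v).
Proof.
move=> subM vM Mx nx xmin; have Mv i : M (v i) by have [[]] := vM i.
have [->|a0] := eqVneq a 0; first by rewrite rmorph0 absC0 mul0r absC_ge0.
have x_gt0 : 0 < absC x.
  by rewrite absC_gt0; apply/eqP => x0; apply: nx; rewrite x0; case: (A_submodule_span v).
have a_gt0 : 0 < absC (A_to_C C a) by rewrite absC_gt0 A_to_C_eq0.
pose t i := b i %/ a; pose u i := b i %% a.
have bE : A_comb b v = A_to_C C a * A_comb t v + A_comb u v.
  rewrite -A_combZ -A_combD; congr (A_comb _ v); apply/funext => i.
  by rewrite mulrC -divp_eq.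
(* Each [u i] has smaller degree than [a], and [x], being outside the span, is at least as long as
   each [v i]. *)
have uLt : absC (A_comb u v) < absC (A_to_C C a) * absC x.
  apply: absC_sum_lt => [|i _]; first exact: mulr_gt0.
  rewrite absCM (@le_lt_trans _ _ (absC (A_to_C C (u i)) * absC x)) //.
    by rewrite ler_wpM2l ?absC_ge0 // (succ_min_le _ vM).
  by rewrite ltr_pM2r // absC_A_to_C_lt // ltn_modpN0.
have xtGe : absC x <= absC (x + A_comb t v).
  have [_ MD _] := subM.
  apply: xmin; first by apply: MD => //; exact: A_submodule_comb.
  move=> [c xtE]; apply: nx; exists (fun i => c i - t i).
  by rewrite A_combB -xtE addrK.
rewrite leNgt; apply/negP => lt.
have : absC (A_to_C C a * (x + A_comb t v)) < absC (A_to_C C a) * absC x.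
  have -> : A_to_C C a * (x + A_comb t v) =
      A_to_C C a * x + A_comb b v - A_comb u v by rewrite bE mulrDr addrA addrK.
  by apply: absC_lt_add; rewrite ?absCN.
by rewrite absCM ltr_pM2l // ltNge xtGe.
Qed.

(** The nontrivial half of orthogonality. [succ_min_cons_le] bounds the head term; the tail is the
    whole sum minus that term, hence no longer than the sum, and induction applies to it. *)
Lemma succ_min_comb_le n (v : 'I_n -> C) M (a : 'I_n -> A) i :
  A_submodule M -> succ_min v M ->
  absC (A_to_C C (a i)) * absC (v i) <= absC (A_comb a v).
Proof.
move=> subM; elim: n v a i => [|n IH] v a i vM; first by case: i.
have wM := succ_min_behead vM; have [[Mx nx] xmin] := vM ord0.
rewrite tail_span0 in nx xmin.
have h0 : absC (A_to_C C (a ord0)) * absC (v ord0) <= absC (A_comb a v).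
  rewrite A_comb_recl; apply: succ_min_cons_le (wM) _ _ _ => //.
  by move=> y My ny; apply: xmin.
case: (unliftP ord0 i) => [j|] -> //.
apply: le_trans (IH _ (fun k => a (lift ord0 k)) j wM) _.
have -> : A_comb (fun k => a (lift ord0 k)) (behead_fam v) =
    A_comb a v - A_to_C C (a ord0) * v ord0 by rewrite A_comb_recl addrC addKr.
by apply: absC_le_add; rewrite ?absCN ?absCM.
Qed.

Lemma succ_min_free n (v : 'I_n -> C) M : A_submodule M -> succ_min v M -> A_free v.
Proof.
move=> subM vM a a0 i; have := succ_min_comb_le a i subM vM.
rewrite a0 absC0 pmulr_lle0 ?absC_gt0 ?(succ_min_neq0 _ vM) // => le0.
by apply/eqP; rewrite -(A_to_C_eq0 C) -absC_eq0 eq_le le0 absC_ge0.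
Qed.

(** * Existence of successive minimum bases *)

Lemma discrete_min M (P : C -> Prop) x0 : discrete M -> M x0 -> P x0 ->
  exists x, [/\ M x, P x & forall y, M y -> P y -> absC x <= absC y].
Proof.
move=> dM Mx0 Px0; have /finite_seqP[s sE] := dM 0 (absC x0).
have inS y : y \in s <-> M y /\ absC y <= absC x0.
  by have := congr1 (fun X : set C => X y) sE; rewrite /= subr0 => <-.
have x0s : x0 \in s by apply/inS.
have [x [xs Px xmin]] := seq_min (@absC _ _ C) x0s Px0.
have [Mx xx0] := iffLR (inS x) xs.
exists x; split=> // y My Py; have [yx0|/ltW] := leP (absC y) (absC x0).
  by apply: xmin => //; apply/inS.
exact: le_trans.
Qed.

(** Minimality forces the ordering: for i <= j the tail span at j lies in the one at i, so [v i]
    avoids it and competes with [v j]. *)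
Lemma succ_min_basisP n (v : 'I_n -> C) M : A_submodule M ->
  succ_min v M -> M `<=` A_span v -> succ_min_basis v M.
Proof.
move=> subM vM Mv; split=> //.
- split; first exact: succ_min_free vM.
  by apply/seteqP; split=> // x [a ->]; apply: A_submodule_comb => // i; have [[]] := vM i.
- move=> i j ij; have [_ h] := vM j; have [[Mi ni] _] := vM i.
  by apply: h; split=> // /(tail_span_leq ij).
Qed.

(** Greedy construction: fewer than [r] vectors cannot span the free family [w], so a shortest
    element outside their span can be added; an element outside the span of [r] vectors would yield
    a free family of [r.+1]. *)
Lemma succ_min_exists M r : A_submodule M -> discrete M -> has_A_rank M r ->
  exists v : 'I_r -> C, succ_min_basis v M.
Proof.
move=> subM dM [[w [Mw fw]] rmax].
have step n (v : 'I_n -> C) x : succ_min v M -> M x -> ~ A_span v x ->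
    exists v' : 'I_n.+1 -> C, succ_min v' M.
  move=> vM Mx nx.
  have [y [My ny ymin]] := @discrete_min M (fun y => ~ A_span v y) x dM Mx nx.
  by exists (cons_fam y v); apply: succ_min_cons.
have : forall n, (n <= r)%N -> exists v : 'I_n -> C, succ_min v M.
  elim=> [_|n IH nr]; first by exists (fun=> 0) => -[].
  have [v vM] := IH (ltnW nr).
  have /existsNP[i ni] : ~ forall i, A_span v (w i).
    by move=> /(A_free_leq fw); rewrite leqNgt nr.
  exact: step vM (Mw i) ni.
move=> /(_ r (leqnn r))[v vM]; exists v; apply: succ_min_basisP => // x Mx.
apply: contrapT => nx; have [v' v'M] := step _ _ _ vM Mx nx.
have := rmax _ v' (fun i => (v'M i).1.1) (succ_min_free subM v'M).
by rewrite ltnn.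
Qed.

(** * Transition determinants and the value of the covolume *)

Lemma succ_min_basis_submodule n (v : 'I_n -> C) M : succ_min_basis v M -> A_submodule M.
Proof. by move=> [[_ <-] _ _]; exact: A_submodule_span. Qed.

Lemma succ_min_basis_prod_gt0 n (v : 'I_n -> C) M :
  succ_min_basis v M -> 0 < \prod_i absC (v i).
Proof.
by move=> [_ _ vM]; apply: prodr_gt0 => i _; rewrite absC_gt0 (succ_min_neq0 _ vM).
Qed.

Lemma succ_min_det_le n (v w : 'I_n -> C) M (T : 'M[A]_n) : succ_min_basis w M ->
  (forall i, v i = A_comb (T i) w) ->
  absC (A_to_C C (\det T)) * \prod_i absC (w i) <= \prod_i absC (v i).
Proof.
move=> wM vE; apply: absC_det_le => [i|i|i j]; rewrite ?absC_ge0 //.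
rewrite vE; apply: succ_min_comb_le (succ_min_basis_submodule wM) _.
by case: wM.
Qed.

(* Both inequalities come from Leibniz' formula: one for [T], the other for
   its adjugate, which expresses [\det T * w] in terms of [v]. *)
Lemma succ_min_det n (v w : 'I_n -> C) M L (T : 'M[A]_n) :
    succ_min_basis v L -> succ_min_basis w M -> v = (fun i => A_comb (T i) w) ->
  \prod_i absC (v i) = absC (A_to_C C (\det T)) * \prod_i absC (w i).
Proof.
move=> vL wM vE; have vEi i : v i = A_comb (T i) w by rewrite vE.
apply/eqP; rewrite eq_le (succ_min_det_le wM vEi) andbT.
have d0 : \det T != 0 by apply: (@A_free_det _ _ w); rewrite -vE; case: vL => -[].
have d_gt0 : 0 < absC (A_to_C C (\det T)) by rewrite absC_gt0 A_to_C_eq0.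
have : absC (A_to_C C (\det (\adj T))) * \prod_i absC (v i) <=
       \prod_i absC (A_to_C C (\det T) * w i).
  by apply: succ_min_det_le vL _ => i; rewrite -adj_comb vE.
(* Multiplying by |det T| turns the determinant of the adjugate into the n-th power of [\det T],
   which also comes out of the right-hand product and cancels. *)
rewrite -(ler_pM2l d_gt0) mulrA -absCM -rmorphM -det_mulmx mul_mx_adj det_scalar.
rewrite (eq_bigr _ (fun i _ => absCM (A_to_C C (\det T)) (w i))).
rewrite big_split prodr_const card_ord rmorphXn absCX.
by rewrite mulrCA ler_pM2l // exprn_gt0.
Qed.

(** A transition matrix between two such bases has nonzero determinant in A, hence of absolute value
    at least 1; exchanging the bases gives equality. *)
Lemma covolumeE n (v : 'I_n -> C) M :
  succ_min_basis v M -> covolume M = \prod_i absC (v i).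
Proof.
move=> vM; rewrite /covolume; apply: xget_unique; first by exists n, v.
have le p q (w : 'I_p -> C) (u : 'I_q -> C) : succ_min_basis w M -> succ_min_basis u M ->
    p = q /\ \prod_i absC (u i) <= \prod_i absC (w i).
  move=> wM uM; have [[fw sw] _ _] := wM; have [[fu su] _ _] := uM.
  have wu i : A_span u (w i) by rewrite su -sw; exact: A_span_gen.
  have uw i : A_span w (u i) by rewrite sw -su; exact: A_span_gen.
  have pq : p = q by apply/eqP; rewrite eqn_leq (A_free_leq fw wu) (A_free_leq fu uw).
  split=> //; subst q; have [T wE] := A_span_matrix wu.
  rewrite (succ_min_det wM uM wE) ler_peMl ?(ltW (succ_min_basis_prod_gt0 uM)) //.
  by apply: absC_A_to_C_ge1; apply: (@A_free_det _ _ u); rewrite -wE.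
move=> _ [p [w [wM ->]]]; apply/eqP; rewrite eq_le.
by rewrite (le _ _ _ _ vM wM).2 (le _ _ _ _ wM vM).2.
Qed.

Lemma lattice_succ_min r M : lattice_of_rank r M ->
  exists v : 'I_r -> C, succ_min_basis v M.
Proof.
move=> [[[n [w ME]] dM] rM]; apply: succ_min_exists dM rM.
by rewrite ME; exact: A_submodule_span.
Qed.

(** Finite generation comes from the successive minimum basis. *)
Lemma lattice_of_rank_submodule r M : A_submodule M -> discrete M -> has_A_rank M r ->
  lattice_of_rank r M.
Proof.
move=> subM dM rM; have [v [[_ Mv] _ _]] := succ_min_exists subM dM rM.
by split=> //; split=> //; exists r, v; rewrite Mv.
Qed.

End Modules.

(** * Sums and intersections of commensurable lattices *)

Section Commensurability.
Variables (R : realType) (F : finFieldType) (C : Cinfty_tower R F) (r : nat).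
Implicit Types (L M N : set C).

Lemma lattice_submodule M : lattice_of_rank r M -> A_submodule M.
Proof. by move=> /lattice_succ_min[v /succ_min_basis_submodule]. Qed.

(** Cramer's rule: [d] is the determinant of a free family of [L] in a basis of [M], and the
    adjugate writes [d] times that basis in the family. *)
Lemma lattice_scale_into L M : lattice_of_rank r L -> lattice_of_rank r M -> L `<=` M ->
  exists2 d : {poly F}, d != 0 & forall x, M x -> L (A_to_C C d * x).
Proof.
move=> latL latM LM; have subL := lattice_submodule latL.
have [_ [[v [Lv fv]] _]] := latL; have [w [[_ Mw] _ _]] := lattice_succ_min latM.
have [T vE] : exists T : 'M_r, v = fun i => A_comb (T i) w.
  by apply: A_span_matrix => i; rewrite Mw; exact/LM/Lv.
exists (\det T); first by apply: (@A_free_det _ _ _ _ _ w); rewrite -vE.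
move=> x; rewrite -Mw => -[a ->]; rewrite mulr_sumr.
under eq_bigr do rewrite mulrCA -adj_comb -vE.
apply: (A_submodule_comb a subL) => i.
exact: A_submodule_comb.
Qed.

Lemma discrete_scale L M (d : {poly F}) : d != 0 ->
  (forall x, M x -> L (A_to_C C d * x)) -> discrete L -> discrete M.
Proof.
move=> d0 ML dL c rho; set z := A_to_C C d in ML.
have z0 : z != 0 by rewrite A_to_C_eq0.
apply: (sub_finite_set _ (finite_image (fun y => z^-1 * y)
  (dL (z * c) (absC z * rho)))) => x [Mx xc].
exists (z * x); last by rewrite mulKf.
split; first exact: ML.
by rewrite /= -mulrBr absCM ler_wpM2l ?absC_ge0.
Qed.

(** Multiplication by [d] carries free families of [M] to free families of [L]. *)
Lemma has_A_rank_scale L M (d : {poly F}) : d != 0 -> L `<=` M ->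
  (forall x, M x -> L (A_to_C C d * x)) -> has_A_rank L r -> has_A_rank M r.
Proof.
move=> d0 LM ML [[v [Lv fv]] rmax]; split.
  by exists v; split=> // i; apply: LM.
move=> n u Mu fu; apply: (rmax n (fun i => A_to_C C d * u i)) => [i|a].
  exact: ML.
move=> a0; apply: fu; apply: (mulfI (x := A_to_C C d)); first by rewrite A_to_C_eq0.
rewrite mulr0 -[RHS]a0 mulr_sumr; apply: eq_bigr => i _.
by rewrite mulrCA.
Qed.

Lemma has_A_rank_between L M N :
  L `<=` N -> N `<=` M -> has_A_rank L r -> has_A_rank M r -> has_A_rank N r.
Proof.
move=> LN NM [[v [Lv fv]] _] [_ rmax]; split.
  by exists v; split=> // i; apply: LN.
by move=> n u Nu; apply: rmax => i; apply: NM.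
Qed.

Lemma set_add_subl M N : A_submodule N -> M `<=` set_add M N.
Proof. by move=> [N0 _ _] x Mx; exists x => //; exists 0; rewrite ?addr0. Qed.

Lemma set_add_subr M N : A_submodule M -> N `<=` set_add M N.
Proof. by move=> [M0 _ _] x Nx; exists 0 => //; exists x; rewrite ?add0r. Qed.

Lemma lattice_of_rank_setI L M N : L `<=` M `&` N ->
  lattice_of_rank r L -> lattice_of_rank r M -> lattice_of_rank r N ->
  lattice_of_rank r (M `&` N).
Proof.
move=> LMN latL latM latN; apply: lattice_of_rank_submodule.
- by apply: A_submoduleI; exact: lattice_submodule.
- by move=> c rho; have [[_ dM] _] := latM; apply: sub_finite_set (dM c rho) => x [[]].
- by apply: has_A_rank_between LMN (@subIsetl _ _ _) _ _; [case: latL|case: latM].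
Qed.

Lemma lattice_of_rank_set_add L M N : L `<=` M `&` N ->
  lattice_of_rank r L -> lattice_of_rank r M -> lattice_of_rank r N ->
  lattice_of_rank r (set_add M N).
Proof.
move=> LMN latL latM latN.
have [subL subM subN] := And3 (lattice_submodule latL) (lattice_submodule latM)
  (lattice_submodule latN).
have [d d0 dM] := lattice_scale_into latL latM (fun x Lx => (LMN x Lx).1).
have [e e0 eN] := lattice_scale_into latL latN (fun x Lx => (LMN x Lx).2).
have de x : set_add M N x -> L (A_to_C C (d * e) * x).
  have [_ LD LZ] := subL.
  move=> [y My [z Nz <-]]; rewrite rmorphM mulrDr; apply: LD.
    by rewrite mulrAC mulrC; apply/LZ/dM.
  by rewrite -mulrA; apply/LZ/eN.
have de0 : d * e != 0 by rewrite mulf_neq0.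
apply: lattice_of_rank_submodule; first exact: A_submodule_add.
  by apply: discrete_scale de0 de _; case: latL => -[].
apply: has_A_rank_scale de0 _ de _; last by case: latL.
by move=> x /LMN[Mx _]; apply: set_add_subl.
Qed.

(** * The product formula for covolumes *)

Lemma covolume_gt0 M : lattice_of_rank r M -> 0 < covolume M.
Proof.
by move=> /lattice_succ_min[v vM]; rewrite (covolumeE vM) (succ_min_basis_prod_gt0 vM).
Qed.

Lemma covolumeIM M N : lattice_of_rank r M -> lattice_of_rank r N ->
    lattice_of_rank r (M `&` N) -> lattice_of_rank r (set_add M N) ->
  covolume (M `&` N) * covolume (set_add M N) = covolume M * covolume N.
Proof.
move=> latM latN latI latS.
have [v1 b1] := lattice_succ_min latM; have [v2 b2] := lattice_succ_min latN.
have [v0 b0] := lattice_succ_min latI; have [vS bS] := lattice_succ_min latS.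
have [[f1 s1] _ _] := b1; have [[f2 s2] _ _] := b2.
have [[f0 s0] _ _] := b0; have [[fS sS] _ _] := bS.
have g0 i : (M `&` N) (v0 i) by rewrite -s0; exact: A_span_gen.
have [T1 e1] : exists T : 'M_r, v1 = fun i => A_comb (T i) vS.
  apply: A_span_matrix => i; rewrite sS.
  by apply: set_add_subl (lattice_submodule latN) _ _; rewrite -s1; exact: A_span_gen.
have [T2 e2] : exists T : 'M_r, v2 = fun i => A_comb (T i) vS.
  apply: A_span_matrix => i; rewrite sS.
  by apply: set_add_subr (lattice_submodule latM) _ _; rewrite -s2; exact: A_span_gen.
have [S1 E1] : exists T : 'M_r, v0 = fun i => A_comb (T i) v1.
  by apply: A_span_matrix => i; rewrite s1; case: (g0 i).
have [S2 E2] : exists T : 'M_r, v0 = fun i => A_comb (T i) v2.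
  by apply: A_span_matrix => i; rewrite s2; case: (g0 i).
have e01 : v0 = fun i => A_comb ((S1 *m T1) i) vS.
  by apply/funext => i; rewrite A_comb_mulmx -e1 E1.
have e02 : v0 = fun i => A_comb ((S2 *m T2) i) vS.
  by apply/funext => i; rewrite A_comb_mulmx -e2 E2.
have T0E : S1 *m T1 = S2 *m T2.
  by apply: (A_free_inj fS) => i; rewrite -[LHS](congr1 (@^~ i) e01) (congr1 (@^~ i) e02).
(* Rows of [U] and [V] are the coordinates of a splitting of each [vS i] into an element of [M] and
   one of [N]. *)
have [U [V UV]] : exists U V : 'M_r, U *m T1 + V *m T2 = 1%:M.
  have /choice[U /choice[V UVE]] : forall i : 'I_r, exists a b,
      vS i = A_comb a v1 + A_comb b v2.
    move=> i; have : set_add M N (vS i) by rewrite -sS; exact: A_span_gen.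
    by rewrite -s1 -s2 => -[_ [a ->] [_ [b ->] <-]]; exists a, b.
  exists (\matrix_(i, j) U i j), (\matrix_(i, j) V i j); apply: (A_free_inj fS) => i.
  rewrite A_comb_scalar_mx rmorph1 mul1r UVE A_comb_addmx !A_comb_mulmx -e1 -e2.
  by congr (A_comb _ v1 + A_comb _ v2); apply/funext => j; rewrite mxE.
have cap (X S S' : 'M_r) : X = S *m T1 -> X = S' *m T2 -> exists W, X = W *m (S1 *m T1).
  move=> XS XS'.
  have [W WE] : exists W : 'M_r, (fun i => A_comb (X i) vS) = fun i => A_comb (W i) v0.
    apply: A_span_matrix => i; rewrite s0; split.
      by rewrite XS A_comb_mulmx -e1 -s1; exists (S i).
    by rewrite XS' A_comb_mulmx -e2 -s2; exists (S' i).
  exists W; apply: (A_free_inj fS) => i.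
  by rewrite A_comb_mulmx -e01 [LHS](congr1 (@^~ i) WE).
have [c [d [cE dE]]] := det_capmx_associate UV erefl T0E cap.
have D1 := succ_min_det b1 bS e1; have D2 := succ_min_det b2 bS e2.
have D0 := succ_min_det b0 bS e01.
have n1 : \det T1 != 0 by apply: (@A_free_det _ _ _ _ _ vS); rewrite -e1.
have n2 : \det T2 != 0 by apply: (@A_free_det _ _ _ _ _ vS); rewrite -e2.
have n0 : \det (S1 *m T1) != 0 by apply: (@A_free_det _ _ _ _ _ vS); rewrite -e01.
(* The cofactors [c] and [d] are nonzero because the determinants are, so each has absolute value at
   least 1 and each divisibility gives one inequality. *)
have nE : absC (A_to_C C (\det (S1 *m T1))) =
    absC (A_to_C C (\det T1)) * absC (A_to_C C (\det T2)).
  rewrite -absCM -rmorphM; apply/eqP; rewrite eq_le; apply/andP; split.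
    rewrite dE rmorphM absCM ler_peMl ?absC_ge0 // absC_A_to_C_ge1 //.
    by apply: contra_neq (mulf_neq0 n1 n2) => d0; rewrite dE d0 mul0r.
  rewrite [in leRHS]cE (rmorphM _ c) (absCM (_ c)) ler_peMl ?absC_ge0 // absC_A_to_C_ge1 //.
  by apply: contra_neq n0 => c0; rewrite cE c0 mul0r.
rewrite (covolumeE b0) (covolumeE b1) (covolumeE b2) (covolumeE bS) D0 D1 D2 nE.
by rewrite mulrACA mulrA.
Qed.

End Commensurability.

Theorem theorem2p6 (R : realType) (F : finFieldType) (C : Cinfty_tower R F)
    (r : nat) (L L1 L2 : set C) :
  (1 <= r)%N ->
  lattice_of_rank r L -> lattice_of_rank r L1 -> lattice_of_rank r L2 ->
  L `<=` L1 `&` L2 ->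
  [/\ lattice_of_rank r (L1 `&` L2),
      lattice_of_rank r (set_add L1 L2)
    & logq F (covolume (L1 `&` L2)) + logq F (covolume (set_add L1 L2)) =
      logq F (covolume L1) + logq F (covolume L2)].
Proof.
move=> _ latL lat1 lat2 LL12.
have latI := lattice_of_rank_setI LL12 latL lat1 lat2.
have latS := lattice_of_rank_set_add LL12 latL lat1 lat2.
split=> //; have gt0 (M : set C) : lattice_of_rank r M -> covolume M \is Num.pos.
  by rewrite posrE => /covolume_gt0.
rewrite /logq -!mulrDl -(lnM (gt0 _ latI) (gt0 _ latS)).
by rewrite -(lnM (gt0 _ lat1) (gt0 _ lat2)) (covolumeIM lat1 lat2).
Qed.
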